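(* Let $n\ge3$ and let $G$ be the leafed $n$-cycle: the cycle on vertices $0,1,\ldots,n-1$ (labeled cyclically) together with an extra vertex $n$ adjacent only to vertex $0$. Let $L_n$ be the Laplacian of $G$ with the row and column of vertex $n$ deleted (indices $0,\ldots,n-1$). Let $\mathcal{C}_n=\{\lambda\in\mathbb{R}^n: L_n\lambda\ge0\}$ and $\sigma_{\mathcal{C}_n}(q)=\sum_{\lambda\in\mathcal{C}_n\cap\mathbb{Z}^n}q^{\lambda_0}$. Let $S_n$ be the set of vectors $c=(c_0,\ldots,c_{n-1})$ with $c_j\in\{0,1,\ldots,n-1\}$ satisfying $0\cdot c_0+\sum_{j=1}^{n-1}(n-j)c_j\equiv0\pmod n$, and for $c\in S_n$ put $\phi(c)=\sum_{j=0}^{n-1}c_j$. Then \[\sigma_{\mathcal{C}_n}(q)=\frac{\sum_{c\in S_n}q^{\phi(c)}}{(1-q^n)^n}.\]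
   Context: The Laplacian of a simple graph is $L=D-A$ with $D$ the diagonal degree matrix and $A$ the $0/1$ adjacency matrix. Explicitly, $L_n$ has $(0,0)$ entry $3$, diagonal entries $2$ otherwise, entries $-1$ in positions $(i,j)$ with $i,j$ adjacent on the cycle, and $0$ elsewhere. *)

(* Defs.v *)
From HB Require Import structures.
From mathcomp Require Import all_boot all_order all_algebra.
From mathcomp Require Import boolp classical_sets functions cardinality reals.

Set Implicit Arguments.
Unset Strict Implicit.
Unset Printing Implicit Defensive.

Import Order.TTheory GRing.Theory Num.Theory.

Local Open Scope ring_scope.

Definition degree (T : finType) (e : rel T) (x : T) : nat := #|[set y | e x y]%SET|.

Definition adjacency (R : pzRingType) (m : nat) (e : rel 'I_m) : 'M[R]_m :=
  \matrix_(i, j) (e i j)%:R.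

Definition laplacian (R : pzRingType) (m : nat) (e : rel 'I_m) : 'M[R]_m :=
  diag_mx (\row_i (degree e i)%:R) - adjacency R e.

(* The first disjunct is the cycle on 0, ..., n-1; the others are the edge
   joining the leaf n to the vertex 0. *)
Definition leafed_cycle (n : nat) : rel 'I_n.+1 := fun i j =>
  [|| [&& (i < n)%N, (j < n)%N &
          (nat_of_ord j == i.+1 %% n)%N || (nat_of_ord i == j.+1 %% n)%N],
      (nat_of_ord i == n) && (nat_of_ord j == 0)%N
    | (nat_of_ord i == 0)%N && (nat_of_ord j == n)].

Definition reduced_laplacian (R : pzRingType) (n : nat) : 'M[R]_n :=
  row' ord_max (col' ord_max (laplacian R (@leafed_cycle n))).

Definition laplacian_cone (R : realType) (n : nat) : set 'cV[R]_n :=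
  [set l | forall i, 0 <= (reduced_laplacian R n *m l) i 0]%classic.

Arguments laplacian_cone R n : clear implicits.

Definition lattice_points (R : realType) (n : nat) (C : set 'cV[R]_n) :
    set 'cV[int]_n :=
  [set z | C (map_mx intr z)]%classic.

(* [is_genfun A w f] states that the formal sum of q^(w x) over x in A is a
   well-defined power series in q, whose coefficients are f: no exponent is
   negative, each exponent k occurs finitely often, and it occurs f k times. *)
Definition is_genfun (T : Type) (A : set T) (w : T -> int) (f : nat -> int) :
    Prop :=
  (forall x, A x -> 0 <= w x) /\
  (forall k : nat, exists2 m : nat,
     f k = m%:Z & ([set x | A x /\ w x = k%:Z] #= `I_m)%classic%card).

(* Power series expansion at 0 of the rational function P / Q, for Q`_0
   invertible: [ratfun_coefs P Q k] lists the first k coefficients f_i, which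
   are obtained by solving Q * f = P degree by degree. *)
Fixpoint ratfun_coefs (R : comUnitRingType) (P Q : {poly R}) (k : nat) : seq R :=
  if k is k'.+1 then
    let s := ratfun_coefs P Q k' in
    rcons s ((P`_k' - \sum_(i < k') Q`_(k' - i) * s`_i) / Q`_0)
  else [::].

Definition ratfun_series (R : comUnitRingType) (P Q : {poly R}) (k : nat) : R :=
  (ratfun_coefs P Q k.+1)`_k.

Lemma size_ratfun_coefs (R : comUnitRingType) (P Q : {poly R}) k :
  size (ratfun_coefs P Q k) = k.
Proof. by elim: k => //= k IHk; rewrite size_rcons IHk. Qed.

Lemma nth_ratfun_coefs (R : comUnitRingType) (P Q : {poly R}) k i :
  (i < k)%N -> (ratfun_coefs P Q k)`_i = ratfun_series P Q i.
Proof.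
elim: k => // k IHk; rewrite ltnS leq_eqVlt => /predU1P[-> //|lt_ik] /=.
by rewrite nth_rcons size_ratfun_coefs lt_ik IHk.
Qed.

Lemma mul_ratfun_series (R : comUnitRingType) (P Q : {poly R}) k :
  Q`_0 \is a GRing.unit ->
  \sum_(i < k.+1) Q`_(k - i) * ratfun_series P Q i = P`_k.
Proof.
move=> uQ; rewrite big_ord_recr /= subnn {2}/ratfun_series /=.
rewrite nth_rcons size_ratfun_coefs ltnn eqxx mulrC divrK //.
by rewrite addrC -[RHS](subrK (\sum_(i < k) Q`_(k - i) * ratfun_series P Q i));
  congr (_ - _ + _); apply: eq_bigr => i _; rewrite nth_ratfun_coefs.
Qed.

Definition residue_set (n : nat) : {set {ffun 'I_n -> 'I_n}} :=
  [set c : {ffun 'I_n -> 'I_n} |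
     (\sum_(j < n) (if nat_of_ord j == 0 then 0 else n - j) * c j
        == 0 %[mod n])%N]%SET.

Definition phi (n : nat) (c : {ffun 'I_n -> 'I_n}) : nat := (\sum_(j < n) c j)%N.

(* Main.v *)
Require Import Defs.
From mathcomp Require Import all_boot all_order all_algebra.
From mathcomp Require Import boolp classical_sets functions cardinality reals.
From mathcomp Require Import zify lra.

(** Put [a = L_n z].  Summing all the entries gives [\sum_i a_i = z_0], and
solving the equations for [i > 0] by second differences gives
[z_j = z_0 + j (z_1 - z_0) - \sum_(0 < k < j) (j - k) a_k].  Going once around
the cycle, an integral [z] with [L_n z = a] exists iff
[n] divides [\sum_(0 < k) (n - k) a_k], and it is then unique.  Hence the series
counts the nonnegative vectors [a] subject to this congruence by their sum.
Writing [a = c + n b] with [0 <= c_i < n], only [c] has to satisfy the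
congruence, and summing over [b] gives the denominator [(1 - q^n)^n].
To stay with polynomials, [a] is truncated to entries below [N n], which affects
only the coefficients of degree at least [N n]. *)

Import Order.TTheory GRing.Theory Num.Theory.

Local Open Scope ring_scope.

(** * Power series coefficients and finite cardinals *)

(** By induction all terms of the convolution but the last agree, and the last one carries the
    constant coefficient of [Q], a unit. *)
Lemma ratfun_series_eq (R : comUnitRingType) (P Q M : {poly R}) (K : nat) :
  Q`_0 \is a GRing.unit -> (forall i, (i < K)%N -> (Q * M)`_i = P`_i) ->
  forall k, (k < K)%N -> ratfun_series P Q k = M`_k.
Proof.
move=> uQ QM; elim/ltn_ind=> k IHk ltkK.
have := mul_ratfun_series P k uQ; rewrite -QM // coefMr !big_ord_recr /= subnn.
under eq_bigr => i _ do rewrite IHk ?(ltn_trans _ ltkK) //.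
by move/addrI/(mulrI uQ).
Qed.

Lemma coef_mul_1subXn (R : nzRingType) (P : {poly R}) K m i :
  (i < K)%N -> (P * (1 - 'X^K) ^+ m)`_i = P`_i.
Proof.
move=> lti; elim: m => [|m IHm]; first by rewrite mulr1.
by rewrite exprSr mulrA mulrBr mulr1 coefB coefMXn lti subr0.
Qed.

Lemma card_eq_finset (T : finType) (A : {set T}) :
  ([set x | x \in A]%classic #= `I_#|A|)%card.
Proof.
have [->|[x0 _]] := set_0Vmem A.
  rewrite cards0 II0; have -> : [set x | x \in finset.set0]%classic = (@classical_sets.set0 T).
    by apply/seteqP; split=> x //=; rewrite inE.
  exact: card_eq00.
have -> : [set x | x \in A]%classic = [set nth x0 (enum A) i | i in `I_#|A|]%classic.
  apply/seteqP; split=> x /=.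
    rewrite -mem_enum => Ax; exists (index x (enum A)); last exact: nth_index.
    by rewrite cardE index_mem.
  by case=> i; rewrite cardE => lti <-; rewrite -mem_enum mem_nth.
apply: inj_card_eq => i j; rewrite !inE /= !cardE => lti ltj /eqP.
by rewrite nth_uniq ?enum_uniq // => /eqP.
Qed.

(** * Second antidifferences and the congruence modulo [n] *)

Section Moment.

Variable n : nat.

(* The second antidifference of [a] along the cycle, started at vertex 1; at
   [j = n] it is the linear form that defines [residue_set]. *)
Definition moment (a : 'I_n -> nat) (j : nat) : nat :=
  (\sum_(k < n) (if nat_of_ord k == 0 then 0 else j - k) * a k)%N.

Lemma moment0 a : moment a 0 = 0%N.
Proof. by rewrite /moment big1 // => k _; case: ifP. Qed.

Lemma moment1 a : moment a 1 = 0%N.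
Proof. by rewrite /moment big1 // => k _; case: eqP => // /eqP; case: (val k). Qed.

(** As a function of [j], the truncated difference [j - k] is piecewise linear with a single kink at
    [k]: its second difference is 1 there and 0 elsewhere. *)
Lemma momentSS a (i : 'I_n) : (0 < i)%N ->
  (moment a i.+1 + moment a i.-1 = (moment a i).*2 + a i)%N.
Proof.
move=> i_gt0; have -> : a i = (\sum_(k < n) (k == i) * a k)%N.
  by rewrite (bigD1 i) //= eqxx mul1n big1 ?addn0 // => k /negbTE->.
rewrite -addnn /moment -!big_split /=; apply: eq_bigr => k _.
rewrite -!mulnDl -(inj_eq val_inj) /=; congr (_ * _)%N.
by case: ifP; case: eqP => /=; lia.
Qed.

(** Every [k] is at most [n.-1], so no weight is truncated in this last step and each grows by
    one. *)
Lemma moment_last a :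
  moment a n = (moment a n.-1 + \sum_(k < n | nat_of_ord k != 0) a k)%N.
Proof.
rewrite /moment [X in (_ + X)%N]big_mkcond -big_split; apply: eq_bigr => k _ /=.
case: ifP => //= _; have -> : (n - k = (n.-1 - k).+1)%N by have := ltn_ord k; lia.
by rewrite mulSn addnC.
Qed.

Lemma momentD a b j : moment (fun i => a i + b i)%N j = (moment a j + moment b j)%N.
Proof. by rewrite -big_split; apply: eq_bigr => k _; rewrite mulnDr. Qed.

Lemma momentMl m a j : moment (fun i => m * a i)%N j = (m * moment a j)%N.
Proof. by rewrite big_distrr; apply: eq_bigr => k _; rewrite mulnCA. Qed.

Lemma moment_modn a b : moment (fun i => b i * n + a i)%N n = moment a n %[mod n].
Proof.
under eq_fun => i do rewrite mulnC.
by rewrite momentD momentMl mulnC modnMDl.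
Qed.

End Moment.

Arguments moment {n}.

(** * The reduced Laplacian and its integral solutions *)

Lemma mul_laplacianE (R : pzRingType) m (e : rel 'I_m) (v : 'cV[R]_m) i :
  (laplacian R e *m v) i 0 = \sum_(j | e i j) (v i 0 - v j 0).
Proof.
rewrite mulmxBl mul_diag_mx !mxE sumrB; congr (_ - _).
  by rewrite sumr_const mulr_natl; congr (_ *+ _); apply: eq_card => j; rewrite inE.
rewrite [RHS]big_mkcond; apply: eq_bigr => j _.
by rewrite mxE; case: ifP => _; rewrite ?mul1r ?mul0r.
Qed.

Lemma map_reduced_laplacian (R : nzRingType) n :
  map_mx intr (reduced_laplacian int n) = reduced_laplacian R n.
Proof.
apply/matrixP => i j; rewrite !mxE rmorphB /= rmorphMn /=.
by rewrite !rmorph_nat.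
Qed.

Section Cycle.

Variable p : nat.
Local Notation n := p.+3.

(** Deleting the leaf amounts to giving it the value 0, so the leaf edge contributes [z_0 - 0] at
    vertex 0. *)
Lemma mul_reduced_laplacianE (R : pzRingType) (z : 'cV[R]_n) i :
  (reduced_laplacian R n *m z) i 0 =
    (z i 0 - z (ordS i) 0) + (z i 0 - z (ord_pred i) 0) +
    (if i == ord0 then z i 0 else 0).
Proof.
pose v : 'cV[R]_n.+1 := \col_j (if unlift ord_max j is Some k then z k 0 else 0).
have vl k : v (lift ord_max k) 0 = z k 0 by rewrite mxE liftK.
have vw k : v (widen_ord (leqnSn n) k) 0 = z k 0.
  by rewrite -vl; congr (v _ _); apply: val_inj; rewrite /= /bump leqNgt ltn_ord.
have vm : v ord_max 0 = 0 by rewrite mxE unlift_none.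
transitivity ((laplacian R (@leafed_cycle n) *m v) (lift ord_max i) 0).
  rewrite [LHS]mxE [RHS]mxE [RHS]big_ord_recr /= vm mulr0 addr0.
  apply: eq_bigr => j _.
  rewrite vw !mxE; congr (_ * _).
  have -> : lift ord_max j = widen_ord (leqnSn n) j.
    by apply: val_inj; rewrite /= /bump leqNgt ltn_ord.
  by [].
have li : lift ord_max i = i :> nat by rewrite /= /bump leqNgt ltn_ord.
have i_neqn : (nat_of_ord i == n) = false by rewrite ltn_eqF.
have adj j : leafed_cycle (lift ord_max i) (widen_ord (leqnSn n) j) =
    (j == ordS i) || (j == ord_pred i).
  rewrite /leafed_cycle li !ltn_ord /= i_neqn [nat_of_ord j == n]ltn_eqF // andbF !orbF.
  rewrite [j == ord_pred i]eq_sym (can2_eq (@ord_predK n) (@ordSK n)) -!(inj_eq val_inj).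
  by rewrite (ltn_ord j).
(* The two cyclic neighbours of [i] are distinct because 2 is nonzero modulo [n >= 3]. *)
have neqSp : ord_pred i != ordS i.
  rewrite (can2_eq (@ord_predK n) (@ordSK n)) -(inj_eq val_inj) /=.
  by rewrite -{1}(modn_small (ltn_ord i)) -[(i.+1 %% n).+1]addn1 modnDml addn1 -[i.+2]addn2
    -{1}[nat_of_ord i]addn0 eqn_modDl.
rewrite mul_laplacianE vl big_mkcond big_ord_recr /= -big_mkcond /= vm subr0.
congr (_ + _); last by rewrite /leafed_cycle li ltnn i_neqn eqxx andbT andbF.
rewrite (eq_bigl _ _ adj) (bigD1 (ordS i)) ?eqxx //=.
rewrite (bigD1 (ord_pred i)) ?eqxx ?orbT //= !vw big_pred0 ?addr0 // => j.
by case: (j == ordS i); case: (j == ord_pred i).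
Qed.

(** Both cyclic shifts permute the vertices, so the cycle differences cancel and only the leaf edge
    remains. *)
Lemma sum_reduced_laplacian (R : pzRingType) (z : 'cV[R]_n) :
  \sum_i (reduced_laplacian R n *m z) i 0 = z ord0 0.
Proof.
under eq_bigr => i _ do rewrite mul_reduced_laplacianE.
rewrite !big_split /= !sumrN -big_mkcond big_pred1_eq.
have perm_sum (f : 'I_n -> 'I_n) : injective f -> \sum_i z (f i) 0 = \sum_i z i 0.
  by move=> f_inj; rewrite [RHS](reindex_inj f_inj).
by rewrite !perm_sum ?subrr ?add0r //; [exact: ord_pred_inj | exact: ordS_inj].
Qed.

Lemma inZp_ord (i : 'I_n) : inZp i = i.
Proof. by apply: val_inj; rewrite /= modn_small. Qed.

Lemma ordS_inZp j : ordS (inZp j : 'I_n) = inZp j.+1.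
Proof. by apply: val_inj; rewrite /= -[(j %% n).+1]addn1 modnDml addn1. Qed.

Lemma inZp_n : inZp n = ord0 :> 'I_n.
Proof. by apply: val_inj; rewrite /= modnn. Qed.

Lemma ord_pred_inZp j : ord_pred (inZp j.+1 : 'I_n) = inZp j.
Proof. by rewrite -ordS_inZp ordSK. Qed.

(** The range includes [j = n], where [inZp n] is vertex 0 again; that instance says that the
    recurrence closes up around the cycle. *)
Lemma reduced_laplacian_sol (z : 'cV[int]_n) (a : 'I_n -> nat) :
  (forall i, (reduced_laplacian int n *m z) i 0 = a i) ->
  forall j, (j <= n)%N ->
  z (inZp j) 0 = z ord0 0 + (z (inZp 1) 0 - z ord0 0) * j%:Z - (moment a j)%:Z.
Proof.
move=> za; elim/ltn_ind => -[_ _|[_ _|j IHj lejn]].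
- by rewrite moment0 mulr0 subr0 addr0; congr (z _ _); apply: val_inj.
- by rewrite moment1 mulr1 subr0 addrC subrK.
have vj : (inZp j.+1 : 'I_n) = j.+1 :> nat by rewrite /= modn_small.
have neq0 : (inZp j.+1 == ord0 :> 'I_n) = false.
  by apply/eqP => /(congr1 (@nat_of_ord n)); rewrite vj.
have := za (inZp j.+1); rewrite mul_reduced_laplacianE ordS_inZp ord_pred_inZp neq0.
rewrite (IHj j.+1) ?(IHj j) //; try lia.
have := momentSS n a (inZp j.+1); rewrite vj => /(_ isT) /=.
nia.
Qed.

(** The quotient is the only slope [z_1 - z_0] for which a solution can close up at vertex 0; the
    constant term is forced by [sum_reduced_laplacian]. *)
Definition potential (a : 'I_n -> nat) : 'cV[int]_n :=
  \col_i ((\sum_k a k)%N%:Z + (moment a n %/ n)%N%:Z * (nat_of_ord i)%:Z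
          - (moment a i)%:Z).

Lemma potential_inZp a j : (n %| moment a n)%N -> (j <= n)%N ->
  potential a (inZp j) 0 =
    (\sum_k a k)%N%:Z + (moment a n %/ n)%N%:Z * j%:Z - (moment a j)%:Z.
Proof.
move=> dvd_n; rewrite leq_eqVlt => /predU1P[->|ltjn]; last by rewrite mxE /= modn_small.
rewrite inZp_n mxE /= moment0 mulr0 addr0 subr0 -PoszM divnK //.
by rewrite addrK.
Qed.

Lemma mul_reduced_laplacian_potential a i : (n %| moment a n)%N ->
  (reduced_laplacian int n *m potential a) i 0 = a i.
Proof.
move=> dvd_n; rewrite mul_reduced_laplacianE -(inZp_ord i) ordS_inZp.
have lti := ltn_ord i.
case: (posnP i) => [i0|i_gt0].
  have -> : ord_pred (inZp i) = inZp n.-1 :> 'I_n.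
    rewrite i0 (_ : inZp 0 = inZp n) ?ord_pred_inZp //.
    by apply: val_inj; rewrite /= modnn.
  rewrite !potential_inZp ?inZp_ord //; try lia.
  have sum_a : (\sum_k a k = a i + \sum_(k < n | nat_of_ord k != 0) a k)%N.
    by rewrite (bigD1 i) //=; congr (_ + _)%N; apply: eq_bigl => k; rewrite -i0.
  (* At vertex 0 the slopes add up to [moment a n], and [moment_last] leaves the total minus all
     entries other than [a_0]. *)
  have := moment_last n a; have := divnK dvd_n.
  have -> : i == ord0 by apply/eqP/val_inj.
  rewrite sum_a i0 moment0 moment1. nia.
have -> : ord_pred (inZp i) = inZp i.-1 :> 'I_n by rewrite -{1}(prednK i_gt0) ord_pred_inZp.
rewrite !potential_inZp ?inZp_ord //; try lia.
have := momentSS n a i i_gt0.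
have -> : (i == ord0) = false by rewrite -(inj_eq val_inj) gtn_eqF.
nia.
Qed.

End Cycle.

(** * Division with remainder and generating polynomials *)

Section ResidueSet.

Variables (n N : nat).
Hypothesis n_gt0 : (0 < n)%N.

Let ord_mod (a : 'I_(N * n)) : 'I_n := Ordinal (ltn_pmod a n_gt0).

Fact ord_div_subproof (a : 'I_(N * n)) : (a %/ n < N)%N.
Proof. by rewrite ltn_divLR. Qed.

Let ord_div (a : 'I_(N * n)) : 'I_N := Ordinal (ord_div_subproof a).

Fact ord_divmod_subproof (b : 'I_N) (c : 'I_n) : (b * n + c < N * n)%N.
Proof. by have := ltn_ord b; have := ltn_ord c; nia. Qed.

Let ord_divmod b c : 'I_(N * n) := Ordinal (ord_divmod_subproof b c).

Let combine (cb : {ffun 'I_n -> 'I_n} * {ffun 'I_n -> 'I_N}) :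
    {ffun 'I_n -> 'I_(N * n)} :=
  [ffun i => ord_divmod (cb.2 i) (cb.1 i)].

Lemma combine_bij : bijective combine.
Proof.
exists (fun a : {ffun 'I_n -> 'I_(N * n)} =>
          ([ffun i => ord_mod (a i)], [ffun i => ord_div (a i)])) => [[c b]|a].
  congr pair; apply/ffunP => i; apply: val_inj; rewrite !ffunE /=.
    by rewrite modnMDl modn_small.
  by rewrite divnMDl // divn_small // addn0.
by apply/ffunP => i; apply: val_inj; rewrite !ffunE /= -divn_eq.
Qed.

(** The quotients [b_i < N] contribute the [n]-th power of a geometric sum, which [(1 - 'X^n) ^+ n]
    turns into [(1 - 'X^(N * n)) ^+ n], the only trace of the truncation. *)
Lemma residue_set_genpoly (R : comNzRingType) :
  (1 - 'X^n) ^+ n *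
    \sum_(a : {ffun 'I_n -> 'I_(N * n)} | (n %| moment (fun i => a i) n)%N)
      'X^(\sum_i a i)%N =
  (\sum_(c in residue_set n) 'X^(phi c)) * (1 - 'X^(N * n)) ^+ n :> {poly R}.
Proof.
have -> : 1 - 'X^(N * n) = (1 - 'X^n) * \sum_(b < N) 'X^n ^+ b :> {poly R}.
  by rewrite mulnC exprM -opprB subrX1 -mulNr opprB.
rewrite exprMn mulrCA; congr (_ * _).
have -> : (\sum_(b < N) 'X^n ^+ b) ^+ n =
    \sum_(b : {ffun 'I_n -> 'I_N}) \prod_i 'X^n ^+ b i :> {poly R}.
  by rewrite -(bigA_distr_bigA (fun _ (b : 'I_N) => 'X^n ^+ b)) prodr_const card_ord.
rewrite (reindex _ (onW_bij _ combine_bij)) /= big_distrlr /= pair_big /=.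
apply: eq_big => [[c b]|[c b] _] /=.
  (* Multiples of [n] do not change the moment modulo [n], so the condition bears on [c] alone. *)
  rewrite inE andbT mod0n -[RHS]/(n %| moment (fun i => c i) n)%N /dvdn.
  rewrite -(moment_modn n (fun i => c i) (fun i => b i)); congr (_ %% _ == _)%N.
  by apply: eq_bigr => i _; rewrite ffunE.
under [in RHS]eq_bigr => i _ do rewrite -exprM.
rewrite prodrXr -exprD /phi -big_split /=; congr 'X^_.
by apply: eq_bigr => i _; rewrite ffunE /= addnC mulnC.
Qed.

End ResidueSet.

(** * Counting the lattice points of the cone *)

Lemma ratfun_series_residue_set n k : (0 < n)%N ->
  ratfun_series (\sum_(c in residue_set n) 'X^(phi c) : {poly int})
    ((1 - 'X^n) ^+ n) k =
  #|[set a : {ffun 'I_n -> 'I_(k.+1 * n)} |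
      (n %| moment (fun i => a i) n)%N && (\sum_i a i == k)%N]|%:Z.
Proof.
move=> n_gt0.
have unit0 : ((1 - 'X^n) ^+ n : {poly int})`_0 \is a GRing.unit.
  by rewrite -horner_coef0 !hornerE expr0n gtn_eqF // subr0 expr1n.
(* Taking [N = k.+1] moves the effect of the truncation to degrees at least [k.+1 * n], beyond
   [k]. *)
have := residue_set_genpoly n k.+1 n_gt0 int; set M := (X in _ * X = _) => genM.
rewrite (ratfun_series_eq _ _ _ M (k.+1 * n)); first last.
- by rewrite leq_pmulr.
- by move=> i lti; rewrite genM coef_mul_1subXn.
- exact: unit0.
rewrite coef_sum -sum1_card -natz natr_sum.
rewrite [RHS](eq_bigl _ _ (fun a => finset.in_set _ a)) big_mkcondr.
by apply: eq_bigr => a _; rewrite coefXn eq_sym; case: ifP.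
Qed.

Theorem theorem5p1 (R : realType) (n : nat) (n_ge3 : (3 <= n)%N) :
  let vertex0 : 'I_n := Ordinal (ltnW (ltnW n_ge3)) in
  is_genfun (lattice_points (laplacian_cone R n))
    (fun l : 'cV[int]_n => l vertex0 0)
    (ratfun_series (\sum_(c in residue_set n) 'X^(phi c) : {poly int})
                   ((1 - 'X^n) ^+ n)).
Proof.
case: n n_ge3 => [|[|[|p]]] // n_ge3 vertex0; set n := p.+3.
have latticeP z : lattice_points (laplacian_cone R n) z <->
    forall i, 0 <= (reduced_laplacian int n *m z) i 0.
  have mulE i : (reduced_laplacian R n *m map_mx intr z) i 0 =
      ((reduced_laplacian int n *m z) i 0)%:~R.
    by rewrite -map_reduced_laplacian -map_mxM mxE.
  by split=> zge0 i; have := zge0 i; rewrite /= mulE ler0z.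
have -> : vertex0 = ord0 by apply: val_inj.
split=> [z /latticeP z_ge0|k]; first by rewrite -sum_reduced_laplacian sumr_ge0.
eexists; first exact: ratfun_series_residue_set.
set A := [set a | _]%SET.
pose f (a : {ffun 'I_n -> 'I_(k.+1 * n)}) := potential p (fun i => a i).
apply: (card_eq_trans _ (card_eq_finset _ A)).
suff -> : [set z | lattice_points (laplacian_cone R n) z /\ z ord0 0 = k]%classic =
    [set f a | a in [set a | a \in A]]%classic.
  (* Applying the reduced Laplacian to [f a] recovers [a], hence injectivity. *)
  apply: inj_card_eq => a b; rewrite !inE /= !inE => /andP[dvd_a _] /andP[dvd_b _] fab.
  apply/ffunP => i; apply/val_inj/eqP; rewrite -eqz_nat /=.
  rewrite -(mul_reduced_laplacian_potential p (fun i => a i)) //.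
  by rewrite -/(f a) fab mul_reduced_laplacian_potential.
apply/seteqP; split=> [z [/latticeP z_ge0 z0]|_ [a /= aA <-]] /=; last first.
  move: aA; rewrite inE => /andP[dvd_a /eqP sum_a].
  split; first by apply/latticeP => i; rewrite mul_reduced_laplacian_potential.
  rewrite -sum_reduced_laplacian -sum_a -natz natr_sum.
  by apply: eq_bigr => i _; rewrite mul_reduced_laplacian_potential // natz.
pose a i := absz ((reduced_laplacian int n *m z) i 0).
have za i : (reduced_laplacian int n *m z) i 0 = a i by rewrite gez0_abs.
have sum_a : (\sum_i a i = k)%N.
  apply/eqP; rewrite -eqz_nat -z0 -sum_reduced_laplacian -natz natr_sum; apply/eqP.
  by apply: eq_bigr => i _; rewrite za natz.
(* Nonnegative entries of sum [k] are at most [k], so the truncation loses no vector. *)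
have a_lt i : (a i < k.+1 * n)%N.
  have : (a i <= k)%N by rewrite -sum_a (bigD1 i) //= leq_addr.
  nia.
have sol := reduced_laplacian_sol p z a za.
pose t := z (inZp 1) 0 - z ord0 0.
(* At [j = n] both sides contain [z_0], which cancels and identifies the slope [t] with the quotient
   in [potential]. *)
have mom_t : (moment a n)%:Z = t * n.
  have := sol n (leqnn n); rewrite inZp_n -/t; lra.
have tE : t = (moment a n %/ n)%N by nia.
have dvd_a : (n %| moment a n)%N.
  by apply/dvdnP; exists (moment a n %/ n)%N; apply/eqP; rewrite -eqz_nat mom_t tE.
pose b : {ffun 'I_n -> 'I_(k.+1 * n)} := [ffun i => Ordinal (a_lt i)].
have ba : (fun i => nat_of_ord (b i)) = a by apply/funext => i; rewrite ffunE.
exists b.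
  rewrite inE ba dvd_a; apply/eqP; apply: etrans sum_a.
  by apply: eq_bigr => i _; rewrite ffunE.
apply/colP => i; rewrite /f ba -[i in RHS]inZp_ord sol 1?ltnW // mxE -/t.
by rewrite sum_a z0 -tE.
Qed.
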